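(* Let $n \geq 2$ and let $\Omega \subset \mathbb{R}^n$ be a bounded Lipschitz domain. For $p\in(1,\infty)$ define $$C_2(\Omega,p) := \sup_{\substack{w \in W^{1,p}(\Omega),\ w\neq 0\\ \int_{\partial \Omega} w \, \mathrm{d}S= 0}} \frac{\int_{ \Omega} |w|^p \, \mathrm{d}x}{\int_{\Omega}| \nabla w|^p \, \mathrm{d}x}.$$ (i) If $p\geq 2$ and $\alpha \in \left(0, \frac{2^{2-p}|\Omega|}{C_2(\Omega,p) |\partial \Omega| p} \right)$, then $$\lambda_1(\alpha,p,n,\Omega) \geq \alpha \frac{|\partial \Omega|}{|\Omega|} \left(1- \alpha^\frac{1}{p-1} \left( \frac{C_2(\Omega,p) |\partial \Omega| ( p-1 )^{p-1} 2^{(p-2)p} }{|\Omega|-C_2(\Omega,p)\,\alpha\, |\partial \Omega|\, 2^{p-2}p} \right)^\frac{1}{p-1} \right).$$ (ii) If $1 < p \leq 2$ and $\alpha \in \left(0, \frac{|\Omega|}{C_2(\Omega,p) |\partial \Omega| p} \right)$, then $$\lambda_1(\alpha,p,n,\Omega) \geq \alpha \frac{|\partial \Omega|}{|\Omega|} \left(1- \alpha^\frac{1}{p-1} \left( \frac{C_2(\Omega,p) |\partial \Omega| ( p-1 )^{p-1} }{|\Omega|-C_2(\Omega,p)\,\alpha\, |\partial \Omega|\, p} \right)^\frac{1}{p-1} \right).$$ (iii) If $p=2$ and $\alpha \in \left(0, \frac{|\Omega|}{C_2(\Omega,2) |\partial \Omega|} \right)$, then $$\lambda_1(\alpha,2,n,\Omega)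 \geq \alpha \frac{|\partial \Omega|}{|\Omega|} \left(1- \frac{c(\alpha)}{2} \right),$$ where $$c(\alpha) := 2+\frac{\frac{|\Omega|}{|\partial \Omega|} -\alpha C_2(\Omega,2) }{\alpha C_2(\Omega,2) }-\sqrt{\frac{\frac{|\Omega|}{|\partial \Omega|} -\alpha C_2(\Omega,2) }{\alpha C_2(\Omega,2) }}\;\sqrt{4+\frac{\frac{|\Omega|}{|\partial \Omega|} -\alpha C_2(\Omega,2) }{\alpha C_2(\Omega,2) }}.$$
   Context: For $p\in(1,\infty)$, $\alpha\in\mathbb{R}$ and a bounded Lipschitz domain $\Omega\subset\mathbb{R}^n$, $$\lambda_1(\alpha, p,n, \Omega) := \inf_{u \in W^{1,p}(\Omega),\ u\neq 0} \frac{\int_{\Omega} | \nabla u|^{p} \, \mathrm{d}x + \alpha \int_{\partial \Omega} |u|^p \, \mathrm{d}S}{\int_{\Omega } |u|^p \, \mathrm{d}x},$$ where boundary values are understood in the sense of traces, $|\Omega|$ is the Lebesgue measure of $\Omega$ and $|\partial\Omega|$ is the surface measure of $\partial\Omega$. The constant $C_2(\Omega,p)$ is finite by the Poincaré–Wirtinger inequality. *)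

(* Defs.v *)
From HB Require Import structures.
From mathcomp Require Import all_boot all_order all_algebra.
From mathcomp Require Import all_classical all_reals all_analysis.

Set Implicit Arguments.
Unset Strict Implicit.
Unset Printing Implicit Defensive.

Import Order.TTheory GRing.Theory Num.Theory.
Import numFieldNormedType.Exports.

Local Open Scope classical_set_scope.
Local Open Scope ring_scope.

Section gauge_outer.
Local Open Scope ereal_scope.
Context {R : realType} {T : pointedType}.
Variable zeta : set T -> \bar R.
Hypothesis zeta0 : zeta set0 = 0.
Hypothesis zeta_ge0 : forall A, 0 <= zeta A.

(* Unlike [mu_ext], the covering sets are not required to be measurable. *)
Definition gauge_outer (A : set T) : \bar R :=
  ereal_inf [set \sum_(k <oo) zeta (F k) |
             F in [set F : (set T)^nat | A `<=` \bigcup_k F k]].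

Let T' : measurableType _ := g_sigma_algebraType [set: set T].

Let gauge_outerE : gauge_outer = @mu_ext _ T' R zeta.
Proof.
apply/funext => A; rewrite /gauge_outer /mu_ext; congr ereal_inf.
apply/seteqP; split=> x [F].
- by move=> AF <-; exists F => //; split => // k; exact: sub_sigma_algebra.
- by move=> [_ AF] <-; exists F.
Qed.

Lemma gauge_outer0 : gauge_outer set0 = 0.
Proof. by rewrite gauge_outerE; exact: mu_ext0. Qed.

Lemma gauge_outer_ge0 A : 0 <= gauge_outer A.
Proof. by rewrite gauge_outerE; exact: mu_ext_ge0. Qed.

Lemma le_gauge_outer : {homo gauge_outer : A B / A `<=` B >-> A <= B}.
Proof. by rewrite gauge_outerE => A B; exact: (@le_mu_ext _ T' R zeta). Qed.

Lemma gauge_outer_sigma_subadditive : sigma_subadditive gauge_outer.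
Proof. by rewrite gauge_outerE; exact: (@mu_ext_sigma_subadditive _ T' R zeta zeta_ge0). Qed.

End gauge_outer.

Section euclidean.
Context {R : realType} {n : nat}.
Implicit Types x y : 'rV[R]_n.

Definition dotv x y : R := \sum_(i < n) x 0 i * y 0 i.

(* The library norm on ['rV[R]_n] is the sup norm. *)
Definition enorm x : R := Num.sqrt (dotv x x).

Definition ediam (A : set 'rV[R]_n) : \bar R :=
  ereal_sup [set (enorm (x - y))%:E | x in A & y in A].

Definition boundary (A : set 'rV[R]_n) : set 'rV[R]_n := closure A `\` A°.

(* [y |-> y - (dotv y nu) *: nu] is the orthogonal projection on the hyperplane
   orthogonal to [nu]: up to a rigid motion, [phi] is a Lipschitz function of
   [n - 1] variables and, near [x], [Omega] is the region above its graph. *)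
Definition lipschitz_graph_near (Omega : set 'rV[R]_n) x : Prop :=
  exists (r : R) (nu : 'rV[R]_n) (phi : 'rV[R]_n -> R),
    [/\ 0 < r, enorm nu = 1, [lipschitz phi y | y in [set: 'rV[R]_n]] &
      forall y, enorm (y - x) < r ->
        (Omega y <-> phi (y - dotv y nu *: nu) < dotv y nu)].

Definition bounded_lipschitz_domain (Omega : set 'rV[R]_n) : Prop :=
  [/\ Omega !=set0, open Omega, connected Omega, bounded_set Omega &
      forall x, boundary Omega x -> lipschitz_graph_near Omega x].

End euclidean.

Section lebesgue.
Local Open Scope ereal_scope.
Context {R : realType} {n : nat}.

Definition box (a b : 'rV[R]_n) : set 'rV[R]_n :=
  [set x | forall i, (a 0 i <= x 0 i <= b 0 i)%R].

(* Least volume of a box containing [A], [+oo] if [A] is unbounded; the value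
   at [set0] only needs to be forced when [n = 0]. *)
Definition box_gauge (A : set 'rV[R]_n) : \bar R :=
  if `[< A = set0 >] then 0 else
  ereal_inf [set (\prod_(i < n) (ab.2 0 i - ab.1 0 i))%R%:E |
    ab in [set ab : 'rV[R]_n * 'rV[R]_n |
           (forall i, (ab.1 0 i <= ab.2 0 i)%R) /\ A `<=` box ab.1 ab.2]].

Lemma box_gauge0 : box_gauge set0 = 0.
Proof. by rewrite /box_gauge asboolT. Qed.

Lemma box_gauge_ge0 A : 0 <= box_gauge A.
Proof.
rewrite /box_gauge; case: ifP => // _; apply: le_ereal_inf_tmp => _ [ab [h _] <-].
by rewrite lee_fin; apply: prodr_ge0 => i _; rewrite subr_ge0.
Qed.

Definition lebesgue_outer : set 'rV[R]_n -> \bar R := gauge_outer box_gauge.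

HB.instance Definition _ := isOuterMeasure.Build R _ lebesgue_outer
  (gauge_outer0 box_gauge0 box_gauge_ge0) (gauge_outer_ge0 box_gauge_ge0)
  (@le_gauge_outer _ _ box_gauge)
  (gauge_outer_sigma_subadditive box_gauge_ge0).

Let lebT : measurableType _ := caratheodory_type lebesgue_outer.

Definition leb : set lebT -> \bar R := lebesgue_outer.

HB.instance Definition _ := isMeasure.Build _ lebT R leb
  (@caratheodory_measure0 _ _ lebesgue_outer)
  (@caratheodory_measure_ge0 _ _ lebesgue_outer)
  (@caratheodory_measure_sigma_additive _ _ lebesgue_outer).

End lebesgue.
Arguments lebesgue_outer R n : clear implicits.
Arguments leb R n : clear implicits.

Section hausdorff.
Local Open Scope ereal_scope.
Context {R : realType} {n : nat}.
Variable k : nat.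

Definition unit_ball_volume : R :=
  fine (leb R k [set x | (enorm x <= 1)%R]).

Definition hausdorff_gauge (delta : R) (A : set 'rV[R]_n) : \bar R :=
  if `[< A = set0 >] then 0
  else if ediam A <= delta%:E
       then (unit_ball_volume * (fine (ediam A) / 2) ^+ k)%R%:E
       else +oo.

Lemma hausdorff_gauge0 delta : hausdorff_gauge delta set0 = 0.
Proof. by rewrite /hausdorff_gauge asboolT. Qed.

Lemma hausdorff_gauge_ge0 delta A : 0 <= hausdorff_gauge delta A.
Proof.
rewrite /hausdorff_gauge; case: ifPn => // /asboolPn/eqP/set0P[x Ax].
case: ifP => // _; rewrite lee_fin mulr_ge0 ?fine_ge0 ?measure_ge0//.
rewrite exprn_ge0// divr_ge0// fine_ge0//.
apply: (@le_trans _ _ (enorm (x - x))%:E); first by rewrite lee_fin sqrtr_ge0.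
by apply: ereal_sup_ubound; exists x => //; exists x.
Qed.

(* The [k]-dimensional Hausdorff measure, normalized so as to agree with the
   surface area of [k]-dimensional Lipschitz graphs. *)
Definition hausdorff_outer (A : set 'rV[R]_n) : \bar R :=
  ereal_sup [set gauge_outer (hausdorff_gauge delta) A |
             delta in [set delta : R | (0 < delta)%R]].

Lemma hausdorff_outer_ge0 A : 0 <= hausdorff_outer A.
Proof.
apply: le_trans (gauge_outer_ge0 (hausdorff_gauge_ge0 1%R) A) _.
by apply: ereal_sup_ubound; exists 1%R => /=.
Qed.

Lemma hausdorff_outer0 : hausdorff_outer set0 = 0.
Proof.
apply/eqP; rewrite eq_le hausdorff_outer_ge0 andbT.
apply: ge_ereal_sup => _ [d _ <-].
by rewrite (gauge_outer0 (hausdorff_gauge0 d) (hausdorff_gauge_ge0 d)).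
Qed.

Lemma le_hausdorff_outer : {homo hausdorff_outer : A B / A `<=` B >-> A <= B}.
Proof.
move=> A B AB; apply: ge_ereal_sup => _ [d d0 <-].
apply: (@le_trans _ _ (gauge_outer (hausdorff_gauge d) B)).
  exact: le_gauge_outer.
by apply: ereal_sup_ubound; exists d.
Qed.

Lemma hausdorff_outer_sigma_subadditive : sigma_subadditive hausdorff_outer.
Proof.
move=> F; apply: ge_ereal_sup => _ [d d0 <-].
apply: (le_trans (gauge_outer_sigma_subadditive (hausdorff_gauge_ge0 d) F)).
apply: lee_nneseries => i _.
  by move=> _; exact: (gauge_outer_ge0 (hausdorff_gauge_ge0 d)).
by apply: ereal_sup_ubound; exists d.
Qed.

HB.instance Definition _ := isOuterMeasure.Build R _ hausdorff_outer
  hausdorff_outer0 hausdorff_outer_ge0 le_hausdorff_outer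
  hausdorff_outer_sigma_subadditive.

Let hausdorffT : measurableType _ := caratheodory_type hausdorff_outer.

Definition hausdorff : set hausdorffT -> \bar R := hausdorff_outer.

HB.instance Definition _ := isMeasure.Build _ hausdorffT R hausdorff
  (@caratheodory_measure0 _ _ hausdorff_outer)
  (@caratheodory_measure_ge0 _ _ hausdorff_outer)
  (@caratheodory_measure_sigma_additive _ _ hausdorff_outer).

End hausdorff.
Arguments hausdorff_outer R n k : clear implicits.
Arguments hausdorff R n k : clear implicits.

Section sobolev.
Context {R : realType} {n : nat}.
Implicit Types (Omega : set 'rV[R]_n) (u g f : 'rV[R]_n -> R)
  (Du : 'rV[R]_n -> 'rV[R]_n) (p alpha : R).

Definition surf := hausdorff R n n.-1.

Definition partial (i : 'I_n) f : 'rV[R]_n -> R :=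
  fun x => 'D_(delta_mx 0 i) f x.

Definition grad f : 'rV[R]_n -> 'rV[R]_n := fun x => \row_i partial i f x.

Definition smooth f : Prop :=
  forall s : seq 'I_n, let h := foldr partial f s in
    continuous h /\ forall i x, derivable h x (delta_mx 0 i).

Definition test_function Omega f : Prop :=
  [/\ smooth f, compact (closure [set x | f x != 0]) &
      closure [set x | f x != 0] `<=` Omega].

Definition Lp_on d (T : measurableType d) (mu : {measure set T -> \bar R})
    (D : set T) p (f : T -> R) : Prop :=
  measurable_fun D f /\ (\int[mu]_(x in D) (`|f x| `^ p)%:E < +oo)%E.

Definition weak_gradient Omega u Du : Prop :=
  forall f, test_function Omega f -> forall i : 'I_n,
    (\int[leb R n]_(x in Omega) (u x * partial i f x)%:E =
     - \int[leb R n]_(x in Omega) (Du x 0 i * f x)%:E)%E.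

Definition W1p Omega p u Du : Prop :=
  [/\ Lp_on (leb R n) Omega p u,
      forall i, Lp_on (leb R n) Omega p (fun x => Du x 0 i) &
      weak_gradient Omega u Du].

(* [g] is the trace of [u] on the boundary. The trace operator is the continuous
   extension of the restriction map from the dense subspace of smooth functions,
   so its graph is the closure of the graph of that map. *)
Definition trace Omega p u Du g : Prop :=
  Lp_on surf (boundary Omega) p g /\
  exists v : nat -> 'rV[R]_n -> R,
  [/\ forall k, smooth (v k),
      (\int[leb R n]_(x in Omega) (`|v k x - u x| `^ p)%:E)%E
        @[k --> \oo] --> 0%E,
      (\int[leb R n]_(x in Omega) (enorm (grad (v k) x - Du x) `^ p)%:E)%E
        @[k --> \oo] --> 0%E &
      (\int[surf]_(x in boundary Omega) (`|v k x - g x| `^ p)%:E)%E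
        @[k --> \oo] --> 0%E].

(* A function of [W^{1,p}(Omega)] with its weak gradient and its trace, the last
   two being determined almost everywhere by the first. *)
Definition W1p_trace Omega p u Du g : Prop :=
  W1p Omega p u Du /\ trace Omega p u Du g.

Definition nonzero_on Omega u : Prop :=
  ~ {ae leb R n, forall x, Omega x -> u x = 0}.

Definition volume Omega : R := fine (leb R n Omega).

Definition perimeter Omega : R := fine (surf (boundary Omega)).

Definition lambda1 alpha p Omega : \bar R :=
  ereal_inf [set l | exists u Du g,
    [/\ W1p_trace Omega p u Du g, nonzero_on Omega u &
      l = ((\int[leb R n]_(x in Omega) (enorm (Du x) `^ p)%:E
            + alpha%:E * \int[surf]_(x in boundary Omega) (`|g x| `^ p)%:E)
           / \int[leb R n]_(x in Omega) (`|u x| `^ p)%:E)%E]].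

(* The denominator does not vanish: [Omega] being connected, [w] would be
   constant, hence zero by the constraint on its trace. *)
Definition C2e Omega p : \bar R :=
  ereal_sup [set l | exists w Dw g,
    [/\ W1p_trace Omega p w Dw g, nonzero_on Omega w,
        (\int[surf]_(x in boundary Omega) (g x)%:E = 0)%E &
      l = (\int[leb R n]_(x in Omega) (`|w x| `^ p)%:E
           / \int[leb R n]_(x in Omega) (enorm (Dw x) `^ p)%:E)%E]].

(* The supremum is finite, by the Poincare-Wirtinger inequality. *)
Definition C2 Omega p : R := fine (C2e Omega p).

End sobolev.

(* Main.v *)
(** Let [c] be the mean over the boundary of the trace [g] of [u], and [w := u - c].
    Then [w] is admissible for [C2], so the integral of [|w|^p] is at most [C2] times that
    of [|grad u|^p], and Jensen's inequality bounds [|boundary| |c|^p] by the integral of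
    [|g|^p]. Convexity gives, for every [0 < s < 1],
    [|w + c|^p <= s^(1-p) |w|^p + (1-s)^(1-p) |c|^p], and choosing [s] so that both terms
    balance yields, for all [p > 1] at once,
    [lambda1 >= alpha |boundary| / |Omega| (1 + t)^(1-p)] with
    [t = (alpha C2 |boundary| / |Omega|)^(1/(p-1))]. The three stated bounds are weaker, by
    Bernoulli's inequality for (i) and (ii).

    Subtracting [c] from [u] preserves the weak gradient because the integral of a partial
    derivative of a test function vanishes, which follows from the translation invariance
    of the Lebesgue measure. The Poincare-Wirtinger inequality is not needed: if the
    supremum defining [C2] is infinite, then [C2 = 0] and the ranges of [alpha] are empty. *)

Require Import Defs.
From mathcomp Require Import all_boot all_order all_algebra.
From mathcomp Require Import all_classical all_reals all_analysis.
From mathcomp Require Import measurable_realfun lra ring zify.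

Import Order.TTheory GRing.Theory Num.Theory.
Import numFieldNormedType.Exports.

Local Open Scope classical_set_scope.
Local Open Scope ring_scope.

(** * Open sets are Lebesgue measurable *)

(** Intersecting each set of a cover of [X] with [A] and with [B] yields covers of both pieces, so
    superadditivity passes from the gauge to its outer measure. This serves half-spaces for the
    Lebesgue measure and separated sets for the Hausdorff measure. *)
Lemma gauge_outer_le_split {R : realType} {T : pointedType}
    (zeta : set T -> \bar R) (zeta_ge0 : forall A, (0 <= zeta A)%E)
    (A B X : set T) :
  (forall Y, zeta (Y `&` A) + zeta (Y `&` B) <= zeta Y)%E ->
  (gauge_outer zeta (X `&` A) + gauge_outer zeta (X `&` B)
   <= gauge_outer zeta X)%E.
Proof.
move=> split; apply: le_ereal_inf_tmp => _ [F XF <-].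
have le_cover C : (gauge_outer zeta (X `&` C) <=
    \sum_(k <oo) zeta (F k `&` C))%E.
  apply: ereal_inf_lbound; exists (fun k => F k `&` C) => //=.
  by rewrite -setI_bigcupl; exact: setSI.
apply: le_trans (leeD (le_cover A) (le_cover B)) _.
rewrite -nneseriesD//; apply: lee_nneseries => // k _ _.
exact: adde_ge0.
Qed.

Section lebesgue.
Context {R : realType} {n : nat}.
Implicit Types (A : set 'rV[R]_n) (a b h x : 'rV[R]_n).

Lemma box_gauge_le A a b : (forall i, a 0 i <= b 0 i) -> A `<=` box a b ->
  (box_gauge A <= (\prod_(i < n) (b 0 i - a 0 i))%:E)%E.
Proof.
move=> ab Aab; rewrite /box_gauge; case: ifPn => _.
  by rewrite lee_fin prodr_ge0// => i _; rewrite subr_ge0.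
by apply: ereal_inf_lbound; exists (a, b).
Qed.

Lemma le_box_gauge A (y : \bar R) : (0 <= y)%E ->
  (forall a b, (forall i, a 0 i <= b 0 i) -> A `<=` box a b ->
    (y <= (\prod_(i < n) (b 0 i - a 0 i))%:E)%E) ->
  A !=set0 -> (y <= box_gauge A)%E.
Proof.
move=> y0 h /set0P/eqP A0; rewrite /box_gauge asboolF//.
by apply: le_ereal_inf_tmp => _ [[a b] /= [ab Aab] <-]; exact: h.
Qed.

Definition halfspace (i : 'I_n) (c : R) : set 'rV[R]_n := [set x | x 0 i <= c].

(** The hyperplane [x 0 i = c] cuts a box around [A] into two boxes whose volumes add up. If it
    misses the box, one of the two pieces of [A] is empty. *)
Lemma box_gauge_halfspace A (i : 'I_n) (c : R) :
  (box_gauge (A `&` halfspace i c)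
   + box_gauge (A `&` ~` halfspace i c)
   <= box_gauge A)%E.
Proof.
have [->|/set0P A0] := eqVneq A set0.
  by rewrite !set0I !box_gauge0 adde0.
apply: le_box_gauge => //; first by rewrite adde_ge0// box_gauge_ge0.
move=> a b ab Aab.
have [ca|ac] := ltP c (a 0 i).
  rewrite (_ : A `&` _ = set0) ?box_gauge0 ?add0e; last first.
    apply/seteqP; split => // x [/Aab /(_ i)/andP[ax _]].
    by rewrite /halfspace/= leNgt (lt_le_trans ca).
  by apply: box_gauge_le => //; apply: subset_trans Aab; exact: subIsetl.
have [bc|cb] := leP (b 0 i) c.
  rewrite (_ : A `&` ~` _ = set0) ?box_gauge0 ?adde0; last first.
    apply/seteqP; split => // x [/Aab /(_ i)/andP[_ xb]].
    by rewrite /halfspace/= (le_trans xb).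
  by apply: box_gauge_le => //; apply: subset_trans Aab; exact: subIsetl.
(* The two halves of the box are [box a b'] and [box a' b]; their side products differ from that of
   [box a b] only in the factor [i]. *)
pose b' : 'rV[R]_n := \row_j (if j == i then c else b 0 j).
pose a' : 'rV[R]_n := \row_j (if j == i then c else a 0 j).
have le1 : (box_gauge (A `&` halfspace i c)
    <= (\prod_(j < n) (b' 0 j - a 0 j))%:E)%E.
  apply: box_gauge_le => [j|x [/Aab xab xc] j]; rewrite mxE.
    by case: eqP => [->|_].
  by case: eqP (xab j) => [->|_ ->//] /andP[-> _].
have le2 : (box_gauge (A `&` ~` halfspace i c)
    <= (\prod_(j < n) (b 0 j - a' 0 j))%:E)%E.
  apply: box_gauge_le => [j|x [/Aab xab /negP xc] j]; rewrite mxE.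
    by case: eqP => [->|_//]; exact: ltW.
  case: eqP (xab j) => [->|_ ->//] /andP[_ ->].
  by rewrite andbT ltW// ltNge.
apply: le_trans (leeD le1 le2) _; rewrite -EFinD lee_fin.
rewrite (bigD1 i)//= [X in _ + X <= _](bigD1 i)//= [leRHS](bigD1 i)//=.
rewrite !mxE eqxx.
rewrite (eq_bigr (fun j => b 0 j - a 0 j)) => [|j /negPf ji]; last first.
  by rewrite mxE ji.
rewrite [X in _ + _ * X](eq_bigr (fun j => b 0 j - a 0 j)) => [|j /negPf ji].
  by rewrite -mulrDl addrC subrKA.
by rewrite mxE ji.
Qed.

Let lebT := caratheodory_type (lebesgue_outer R n).

Lemma measurable_halfspace (i : 'I_n) (c : R) :
  measurable (halfspace i c : set lebT).
Proof.
apply: le_caratheodory_measurable => X.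
apply: gauge_outer_le_split; first exact: box_gauge_ge0.
by move=> Y; exact: box_gauge_halfspace.
Qed.

(** An open set is the union of the half-open boxes with rational corners that it contains, and such
    a box is a finite intersection of differences of half-spaces. *)
Lemma open_leb_measurable (U : set 'rV[R]_n) :
  open U -> measurable (U : set lebT).
Proof.
move=> oU.
pose hbox (ab : 'rV[rat]_n * 'rV[rat]_n) : set lebT := \bigcap_(i in [set: 'I_n])
  (halfspace i (ratr (ab.2 0 i))
   `\` halfspace i (ratr (ab.1 0 i))).
(* Boxes that leave [U] are replaced by the empty set, so that the union runs over a whole countable
   type. *)
pose F ab := if `[< hbox ab `<=` U >] then hbox ab else set0.
have -> : U = \bigcup_ab F ab.
  apply/seteqP; split => x; last by case=> ab _; rewrite /F; case: asboolP => //; apply.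
  move=> Ux; have /nbhs_ballP[e /= e0 xeU] : nbhs x U.
    by move: oU; rewrite openE => /(_ _ Ux).
  have qa i : {q : rat | x 0 i - e < ratr q < x 0 i}.
    have /rat_in_itvoo/cid[q] : x 0 i - e < x 0 i by rewrite gtrBl.
    by rewrite in_itv/=; exists q.
  have qb i : {q : rat | x 0 i < ratr q < x 0 i + e}.
    have /rat_in_itvoo/cid[q] : x 0 i < x 0 i + e by rewrite ltrDl.
    by rewrite in_itv/=; exists q.
  exists (\row_i sval (qa i), \row_i sval (qb i)) => //; rewrite /F asboolT.
    move=> i _; rewrite !mxE/=.
    case: (qa i) (qb i) => p /= /andP[_ px] [q /= /andP[xq _]].
    by split; [exact: ltW|apply/negP; rewrite -ltNge].
  move=> y yab; apply: xeU; split => // i j; rewrite (ord1 i) -ball_normE/= ltr_norml.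
  have := yab j I; rewrite !mxE/=.
  case: (qa j) (qb j) => p /= /andP[xp _] [q /= /andP[_ qx]].
  rewrite /halfspace/= => -[yq /negP]; rewrite -ltNge => py.
  by apply/andP; split; lra.
apply: countable_bigcupT_measurable; first exact: countableP.
move=> ab; rewrite /F; case: ifPn => // _.
apply: fin_bigcap_measurable => [|i _]; first exact: finite_finset.
by apply: measurableD; exact: measurable_halfspace.
Qed.

End lebesgue.

(** * Closed sets are Hausdorff measurable *)

Section hausdorff.
Context {R : realType} {n : nat}.
Implicit Types (A B X Y : set 'rV[R]_n) (x y : 'rV[R]_n) (d delta : R).

(** Separation of sets is expressed below in the sup norm, diameters in the Euclidean one; this
    inequality links the two. *)
Lemma norm_le_enorm x : `|x| <= enorm x.
Proof.
have -> : `|x| = mx_norm x by [].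
rewrite mx_normrE; apply/bigmax_leP; split => [|[i j] _]; first exact: sqrtr_ge0.
rewrite (ord1 i)/= -sqrtr_sqr ler_wsqrtr// /dotv (bigD1 j)//= expr2.
by rewrite lerDl sumr_ge0// => k _; rewrite -expr2 sqr_ge0.
Qed.

Lemma le_ediam A B : A `<=` B -> (ediam A <= ediam B)%E.
Proof.
move=> AB; apply: ereal_sup_le => _ [x Ax [y Ay <-]].
by exists x; [exact: AB|exists y => //; exact: AB].
Qed.

Lemma ediam_ge0 A : A !=set0 -> (0 <= ediam A)%E.
Proof.
move=> [x Ax]; apply: (@le_trans _ _ (enorm (x - x))%:E).
  by rewrite lee_fin sqrtr_ge0.
by apply: ereal_sup_ubound; exists x => //; exists x.
Qed.

Variable k : nat.

Lemma le_hausdorff_gauge delta :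
  {homo @hausdorff_gauge R n k delta : A B / A `<=` B >-> (A <= B)%E}.
Proof.
move=> A B AB; have [->|A0] := eqVneq A set0.
  by rewrite hausdorff_gauge0 hausdorff_gauge_ge0.
have /set0P A0' := A0.
have /set0P B0 : B !=set0 by case: A0' => x /AB; exists x.
rewrite /hausdorff_gauge !asboolF; [|exact/eqP..].
have [Bd|] := leP (ediam B) delta%:E; last by rewrite leey.
have Ad := le_trans (le_ediam _ _ AB) Bd.
rewrite Ad lee_fin ler_wpM2l ?fine_ge0 ?measure_ge0//.
have fA : ediam A \is a fin_num.
  by rewrite ge0_fin_numE ?ediam_ge0// (le_lt_trans Ad) ?ltry.
have fB : ediam B \is a fin_num.
  by rewrite ge0_fin_numE ?ediam_ge0 ?(le_lt_trans Bd) ?ltry//; exact/set0P.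
rewrite lerXn2r ?nnegrE ?divr_ge0 ?fine_ge0 ?ediam_ge0//; first exact/set0P.
by rewrite ler_pM2r ?invr_gt0// fine_le// le_ediam.
Qed.

(** A set meeting both [A] and [B] has diameter at least [d > delta], hence gauge [+oo]; otherwise
    one of the two terms vanishes. *)
Lemma hausdorff_gauge_separated A B d delta Y : delta < d ->
  (forall x y, A x -> B y -> d <= `|x - y|) ->
  (hausdorff_gauge k delta (Y `&` A) + hausdorff_gauge k delta (Y `&` B)
   <= hausdorff_gauge k delta Y)%E.
Proof.
move=> dd sep.
have [->|/set0P[x [Yx Ax]]] := eqVneq (Y `&` A) set0.
  by rewrite hausdorff_gauge0 add0e; apply: le_hausdorff_gauge; exact: subIsetl.
have [->|/set0P[y [Yy By]]] := eqVneq (Y `&` B) set0.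
  by rewrite hausdorff_gauge0 adde0; apply: le_hausdorff_gauge; exact: subIsetl.
rewrite [leRHS]/hausdorff_gauge asboolF; last by move=> Y0; rewrite Y0 in Yx.
rewrite leNgt ifF ?leey//; first by rewrite ltNge leey.
apply/negbTE; rewrite -ltNge (@lt_le_trans _ _ (enorm (x - y))%:E)//.
  by rewrite lte_fin (lt_le_trans dd)// (le_trans (sep _ _ Ax By))// norm_le_enorm.
by apply: ereal_sup_ubound; exists x => //; exists y.
Qed.

Let mu := @hausdorff_outer R n k.

(** The gauge with the smaller bound on diameters is pointwise the larger one, so the supremum
    defining the Hausdorff measure may be taken at arbitrarily small scales. *)
Lemma le_gauge_hausdorff delta1 delta2 A : delta1 <= delta2 ->
  (gauge_outer (hausdorff_gauge k delta2) A
   <= gauge_outer (hausdorff_gauge k delta1) A)%E.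
Proof.
move=> d12; apply: le_ereal_inf_tmp => _ [F AF <-].
apply: (@le_trans _ _ (\sum_(i <oo) hausdorff_gauge k delta2 (F i))%E).
  by apply: ereal_inf_lbound; exists F.
apply: lee_nneseries => [i _ _|i _]; first exact: hausdorff_gauge_ge0.
rewrite /hausdorff_gauge; case: ifPn => // _.
case: ifPn => [d2|d2]; case: ifPn => [d1|d1]; rewrite ?leey//.
by rewrite (le_trans d1) ?lee_fin in d2.
Qed.

Lemma hausdorff_outer_separated A B d : 0 < d ->
  (forall x y, A x -> B y -> d <= `|x - y|) ->
  (mu A + mu B <= mu (A `|` B))%E.
Proof.
move=> d0 sep.
(* The suprema for [A] and [B] involve independent scales; both are passed to a common scale
   [e < d], where the gauge is superadditive. *)
have step delta1 delta2 : 0 < delta1 -> 0 < delta2 ->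
    (gauge_outer (hausdorff_gauge k delta1) A
     + gauge_outer (hausdorff_gauge k delta2) B <= mu (A `|` B))%E.
  move=> d10 d20; pose e := Order.min (Order.min delta1 delta2) (d / 2).
  have e0 : 0 < e by rewrite !lt_min d10 d20 divr_gt0.
  apply: (@le_trans _ _ (gauge_outer (hausdorff_gauge k e) A
                         + gauge_outer (hausdorff_gauge k e) B)%E).
    by apply: leeD; apply: le_gauge_hausdorff; rewrite /e !ge_min lexx ?orbT.
  apply: (@le_trans _ _ (gauge_outer (hausdorff_gauge k e) (A `|` B))); last first.
    by apply: ereal_sup_ubound; exists e.
  have := @gauge_outer_le_split R _ (hausdorff_gauge k e)
    (@hausdorff_gauge_ge0 R n k e) A B (A `|` B).
  rewrite (setIidPr _ _).2; last exact: subsetUl.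
  rewrite (setIidPr _ _).2; last exact: subsetUr.
  apply=> Y.
  apply: hausdorff_gauge_separated sep.
  by rewrite /e gt_min (@ltr_pdivrMr _ 2)// ltr_pMr// ltr1n orbT.
(* With the infinite case set aside all measures are finite, and each supremum can be bounded in
   turn by moving the other term across the inequality. *)
have [->|] := eqVneq (mu (A `|` B)) +oo%E; first exact: leey.
have mu_ge0 C : (0 <= mu C)%E by exact: hausdorff_outer_ge0.
rewrite -ltey => ABfin.
have fin C : (C <= mu (A `|` B))%E -> (0 <= C)%E -> C \is a fin_num.
  by move=> CAB C0; rewrite ge0_fin_numE// (le_lt_trans CAB).
have finB : mu B \is a fin_num.
  by apply: fin => //; apply: le_hausdorff_outer; exact: subsetUr.
rewrite -leeBrDr//; apply: ge_ereal_sup => _ [d1 d10 <-].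
have finA : gauge_outer (hausdorff_gauge k d1) A \is a fin_num.
  apply: fin; last exact: gauge_outer_ge0 (@hausdorff_gauge_ge0 _ _ _ _) _.
  apply: le_trans (_ : _ <= mu A)%E _; first by apply: ereal_sup_ubound; exists d1.
  by apply: le_hausdorff_outer; exact: subsetUl.
rewrite leeBrDr// -leeBrDl//; apply: ge_ereal_sup => _ [d2 d20 <-].
by rewrite leeBrDl// step.
Qed.

(* Caratheodory's criterion: the rings [ring j] two apart are separated, so their
   measures telescope and the tail of the series is small. *)
Lemma closed_hausdorff_measurable B : closed B ->
  measurable (B : set (caratheodory_type mu)).
Proof.
move=> cB; apply: le_caratheodory_measurable => X.
change (mu (X `&` B) + mu (X `&` ~` B) <= mu X)%E.
have [->|] := eqVneq (mu X) +oo%E; first exact: leey.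
rewrite -ltey => Xfin.
have mu_ge0 C : (0 <= mu C)%E by exact: hausdorff_outer_ge0.
have le_mu : {homo mu : C D / C `<=` D >-> (C <= D)%E} by exact: le_hausdorff_outer.
have fin C : C `<=` X -> mu C \is a fin_num.
  by move=> CX; rewrite ge0_fin_numE// (le_lt_trans _ Xfin)// le_mu.
(* [far j] consists of the points at distance at least [1/(j+1)] from [B]; [ring j] is the part of
   [X] gained in passing from [far j] to [far j.+1]. *)
pose far j : set 'rV[R]_n := [set x | forall y, B y -> j.+1%:R^-1 <= `|x - y|].
pose ring j : set 'rV[R]_n := X `&` (far j.+1 `\` far j).
have farS i j : (i <= j)%N -> far i `<=` far j.
  move=> ij x xi y By; apply: le_trans (xi y By).
  by rewrite lef_pV2 ?posrE// ler_nat.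
have fXX j : X `&` far j `<=` X by exact: subIsetl.
have rX j : ring j `<=` X by exact: subIsetl.
have XB : mu (X `&` B) \is a fin_num by apply: fin; exact: subIsetl.
pose m j := fine (mu (X `&` far j)).
have mB j : m j + fine (mu (X `&` B)) <= fine (mu X).
  rewrite -lee_fin EFinD !fineK//; [|exact: fin|exact: fin].
  apply: le_trans (_ : _ <= mu (X `&` far j `|` X `&` B))%E _.
    apply: (@hausdorff_outer_separated _ _ j.+1%:R^-1) => //.
    by move=> x y [_ xf] [_ By]; exact: xf.
  by apply: le_mu => x [[]|[]].
(* A point of [ring j.+1] is closer than [1/(j+2)] to [B], a point of [far j] at least [1/(j+1)]
   away: the gap is the difference of the two. *)
have m_ring j : m j + fine (mu (ring j.+1)) <= m j.+2.
  rewrite -lee_fin EFinD !fineK//; [|exact: fin..].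
  apply: le_trans (_ : _ <= mu (X `&` far j `|` ring j.+1))%E _.
    apply: (@hausdorff_outer_separated _ _ (j.+1%:R^-1 - j.+2%:R^-1)).
      by rewrite subr_gt0 ltf_pV2 ?posrE// ltr_nat.
    move=> x z [_ xf] [_ [_ /existsNP[y /not_implyP[By /negP]]]].
    rewrite -ltNge => zy.
    rewrite lerBlDr (le_trans (xf y By))// (le_trans (ler_distD z _ _))//.
    by rewrite lerD2l ltW.
  apply: le_mu => x [[Xx xf]|[Xx [xf _]]]; split => //.
  by apply: (farS j) xf; rewrite -addn2 leq_addr.
have m_incr j : m j <= m j.+1.
  by rewrite fine_le ?fin//; apply: le_mu; apply: setIS; exact: farS.
have ubm : has_ubound (range m).
  exists (fine (mu X)) => _ [j _ <-].
  by rewrite -[leLHS]addr0 (le_trans _ (mB j))// lerD2l fine_ge0.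
have mL j : m j <= sup (range m) by apply: ub_le_sup => //; exists j.
have LB : sup (range m) + fine (mu (X `&` B)) <= fine (mu X).
  rewrite -lerBrDr; apply: ge_sup; first by exists (m 0%N), 0%N.
  by move=> _ [j _ <-]; rewrite lerBrDr.
(* Summing [m_ring], the even and the odd indices telescope separately, which leaves two terms at
   each end. *)
have tail k0 N : \sum_(i < N) fine (mu (ring (k0 + i).+1)) <=
    m (k0 + N)%N + m (k0 + N).+1 - m k0 - m k0.+1.
  elim: N => [|N IH]; first by rewrite big_ord0 addn0; lra.
  by rewrite big_ord_recr/= addnS; have := m_ring (k0 + N)%N; lra.
have cover k0 : (mu (X `&` ~` B) <= (sup (range m) + (sup (range m) - m k0))%:E)%E.
  pose F i := ring (k0 + i).+1.
  have XBF : X `&` ~` B `<=` X `&` far k0.+1 `|` \bigcup_i F i.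
    move=> x [Xx nBx].
    have [xk|nxk] := pselect (far k0.+1 x); [by left|right].
    (* Here closedness of [B] enters: a point outside [B] has a ball around it that misses [B], so
       it lies in some [far j]. The least such index tells in which ring it lies. *)
    have exf : exists j, `[< far j x >].
      have : nbhs x (~` B) by apply: open_nbhs_nbhs; split => //; exact: closed_openC.
      move=> /nbhs_ballP[e /= e0 xeB].
      exists (Num.trunc e^-1); apply/asboolP => y By.
      rewrite leNgt; apply/negP => xy; apply: (xeB y) By; rewrite -ball_normE/=.
      apply: lt_trans xy _.
      by rewrite invf_plt ?posrE// truncnS_gt.
    have := find_ex_minn exf; case => j /asboolP xj jmin.
    have kj : (k0.+1 < j)%N.
      by rewrite ltnNge; apply/negP => jk; apply: nxk; exact: farS xj.
    exists (j - k0.+2)%N => //; rewrite /F.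
    move: kj xj jmin; case: j => // j kj xj jmin.
    have -> : (k0 + (j.+1 - k0.+2)).+1 = j by lia.
    by do 2!split => //; move=> xj'; have := jmin j (asboolT xj'); rewrite ltnn.
  apply: le_trans (le_mu _ _ XBF) _.
  apply: le_trans (outer_measureU2 mu _ _) _.
  apply: (@le_trans _ _ ((m k0.+1)%:E + (2 * sup (range m) - m k0 - m k0.+1)%:E)%E).
    apply: leeD; first by rewrite fineK// fin.
    apply: le_trans (outer_measure_sigma_subadditive mu F) _.
    apply: lime_le; first by apply: is_cvg_nneseries => *; exact: mu_ge0.
    apply: nearW => N; rewrite big_mkord.
    rewrite (eq_bigr (fun i : 'I_N => (fine (mu (F i)))%:E)); last first.
      by move=> i _; rewrite fineK//; apply: fin; exact: rX.
    rewrite sumEFin lee_fin (le_trans (tail _ _))//.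
    by have := mL (k0 + N)%N; have := mL (k0 + N).+1; lra.
  by rewrite -EFinD lee_fin; lra.
have XnB : mu (X `&` ~` B) \is a fin_num by apply: fin; exact: subIsetl.
rewrite -(fineK XB) -(fineK XnB) -EFinD -[leRHS]fineK ?fin// lee_fin.
apply/ler_addgt0Pr => e e0.
have supm : has_sup (range m) by split => //; exists (m 0%N), 0%N.
(* For [m k0] within [e] of the supremum, [cover] and [LB] add up to the Caratheodory inequality
   with error [e]. *)
have [_ [k0 _ <-] mk] := sup_adherent e0 supm.
have := cover k0; rewrite -(fineK XnB) lee_fin => h.
by move: LB h mk; lra.
Qed.

End hausdorff.

(** * Translation invariance of the Lebesgue measure *)

Section lebesgue_translation.
Context {R : realType} {n : nat}.
Implicit Types (A : set 'rV[R]_n) (a b h x : 'rV[R]_n).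

Lemma le_box_gauge_translate A h :
  (box_gauge ((fun x => x + h)%R @^-1` A) <= box_gauge A)%E.
Proof.
have [->|/set0P A0] := eqVneq A set0.
  by rewrite preimage_set0 !box_gauge0.
apply: le_box_gauge => //; first exact: box_gauge_ge0.
move=> a b ab Aab.
have -> : \prod_(i < n) (b 0 i - a 0 i) =
    \prod_(i < n) ((b - h) 0 i - (a - h) 0 i).
  by apply: eq_bigr => i _; rewrite !mxE opprB addrA subrK.
apply: box_gauge_le => [i|x /Aab xab i]; first by rewrite !mxE lerD2r.
by have := xab i; rewrite !mxE lerBlDr lerBrDr.
Qed.

Lemma lebesgue_outer_translate A h :
  lebesgue_outer R n ((fun x => x + h) @^-1` A) = lebesgue_outer R n A.
Proof.
have le B k : (lebesgue_outer R n ((fun x => x + k)%R @^-1` B) <=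
               lebesgue_outer R n B)%E.
  apply: le_ereal_inf_tmp => _ [F BF <-].
  apply: (@le_trans _ _
    (\sum_(i <oo) box_gauge ((fun x => x + k)%R @^-1` (F i)))%E).
    apply: ereal_inf_lbound.
    exists (fun i => (fun x => x + k) @^-1` (F i)) => //= x /BF[i _ Fi].
    by exists i.
  apply: lee_nneseries => [i _ _|i _]; first exact: box_gauge_ge0.
  exact: le_box_gauge_translate.
apply/eqP; rewrite eq_le le/=.
(* The reverse inequality is the same one for the translation by [- h], applied to the preimage. *)
rewrite [X in (lebesgue_outer R n X <= _)%E]
  (_ : A = (fun x => x + (- h)) @^-1` ((fun x => x + h) @^-1` A)) ?le//.
by apply/seteqP; split => x /=; rewrite subrK.
Qed.

Lemma bounded_lebesgue_outer A (N : R) : (forall x, A x -> `|x| <= N) ->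
  (lebesgue_outer R n A < +oo)%E.
Proof.
move=> AN.
have [->|/set0P[x0 Ax0]] := eqVneq A set0; first by rewrite outer_measure0.
have N0 : 0 <= N by rewrite (le_trans _ (AN _ Ax0)).
(* The cover is [A] itself followed by empty sets; [A] lies in the cube of half-side [N]. *)
pose F (i : nat) : set 'rV[R]_n := if i is 0%N then A else set0.
have : (lebesgue_outer R n A <= \sum_(i <oo) box_gauge (F i))%E.
  by apply: ereal_inf_lbound; exists F => // x Ax; exists 0%N.
move=> /le_lt_trans; apply.
rewrite (@nneseries_split _ _ 0 1) ?add0n; last by move=> *; exact: box_gauge_ge0.
rewrite big_nat1 eseries0 ?adde0; last first.
  by case=> // i _ _; exact: box_gauge0.
apply: le_lt_trans (ltry _); apply: (@box_gauge_le _ _ _ (const_mx (- N)) (const_mx N)).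
  by move=> i; rewrite !mxE; lra.
move=> x Ax i; rewrite !mxE -ler_norml; apply: le_trans (AN _ Ax).
rewrite [leRHS]/Num.norm/= mx_normrE; apply/bigmax_geP; right.
by exists (0, i).
Qed.

Let lebT : measurableType _ := caratheodory_type (lebesgue_outer R n).

Lemma measurable_translate (h : 'rV[R]_n) :
  measurable_fun (@setT lebT) ((fun x : 'rV[R]_n => x + h) : lebT -> lebT).
Proof.
move=> _ A mA; rewrite setTI.
change ((lebesgue_outer R n).-caratheodory A) in mA.
suff : (lebesgue_outer R n).-caratheodory ((fun x => x + h) @^-1` A) by [].
move=> X.
have shift B : ((fun x => x + h) @^-1` ((fun x => x - h) @^-1` B)) = B.
  by apply/seteqP; split => x /=; rewrite addrK.
(* The Caratheodory condition of [A] is used on the translated test set, then both pieces are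
   translated back. *)
rewrite /= -(lebesgue_outer_translate X (- h)) mA; congr (_ + _)%E.
  rewrite -[LHS](lebesgue_outer_translate _ h); congr (lebesgue_outer R n _).
  by rewrite -[X in _ = X `&` _]shift preimage_setI.
rewrite -[LHS](lebesgue_outer_translate _ h); congr (lebesgue_outer R n _).
by rewrite -[X in _ = X `&` _]shift preimage_setI.
Qed.

(** The pushforward of the Lebesgue measure under a translation is the measure itself; this settles
    nonnegative functions, and the positive and negative parts give the rest. *)
Lemma integral_translate (f : lebT -> \bar R) (h : 'rV[R]_n) :
  measurable_fun (@setT lebT) f ->
  (\int[leb R n]_x f (x + h)%R = \int[leb R n]_x f x)%E.
Proof.
move=> mf; pose phi : lebT -> lebT := fun x => x + h.
have mphi : measurable_fun (@setT lebT) phi by exact: measurable_translate.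
have ge0 (g : lebT -> \bar R) : measurable_fun (@setT lebT) g ->
    (forall x, 0 <= g x)%E ->
    (\int[leb R n]_x (g \o phi) x = \int[leb R n]_x g x)%E.
  move=> mg g0.
  rewrite -(@ge0_integral_pushforward _ _ _ _ _ phi mphi (leb R n) setT g)//.
  apply: eq_measure_integral => A mA _.
  exact: lebesgue_outer_translate.
change (\int[leb R n]_x (f \o phi) x = \int[leb R n]_x f x)%E.
rewrite integralE [RHS]integralE funepos_comp funeneg_comp !ge0//.
- exact: measurable_funeneg.
- exact: measurable_funepos.
Qed.

Lemma continuous_leb_measurable (f : 'rV[R]_n -> R) : continuous f ->
  measurable_fun (@setT lebT) (f : lebT -> R).
Proof.
move=> /continuousP cf; apply: (measurability _ (RGenOpens.measurableE R)).
move=> _ [_ [a [b ->]] <-]; rewrite setTI; apply: open_leb_measurable.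
by apply: cf; exact: interval_open.
Qed.

End lebesgue_translation.

(** * Integral of a partial derivative *)

Section integral_partial.
Context {R : realType} {n : nat}.
Implicit Types (f : 'rV[R]_n -> R) (x : 'rV[R]_n).
Let lebT : measurableType _ := caratheodory_type (lebesgue_outer R n).

Lemma compact_support_integrable f (M N : R) : continuous f ->
  (forall x, `|f x| <= M) -> (forall x, N <= `|x| -> f x = 0) ->
  (leb R n).-integrable (@setT lebT) (EFin \o f).
Proof.
move=> cf fM f0.
have oB : open (ball (0 : 'rV[R]_n) N) by exact: ball_open.
have mB := open_leb_measurable _ oB.
have -> : EFin \o f = (EFin \o f) \_ (ball (0 : 'rV[R]_n) N).
  apply/funext => x; rewrite /restrict; case: ifPn => //.
  rewrite notin_setE -ball_normE/= sub0r normrN => /negP; rewrite -leNgt.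
  by move=> /f0 ->.
apply: (integrable_mkcond _ mB).1.
apply: measurable_bounded_integrable => //.
- apply: (bounded_lebesgue_outer _ N) => x; rewrite -ball_normE/= sub0r normrN.
  exact: ltW.
- exact/measurable_funTS/continuous_leb_measurable.
- exists M; split; first exact: num_real.
  by move=> y My x _ /=; apply: le_trans (fM x) (ltW My).
Qed.

Lemma partial_mean_value f (i : 'I_n) (M t : R) x :
  (forall y, derivable f y (delta_mx 0 i)) ->
  (forall y, `|partial i f y| <= M) -> 0 < t ->
  `|f (x + t *: delta_mx 0 i) - f x| <= M * t.
Proof.
move=> df fM t0; pose e : 'rV[R]_n := delta_mx 0 i.
pose phi (s : R) := f (s *: e + x).
have dphi (s : R) : is_derive s 1 phi (partial i f (s *: e + x)).
  (* The difference quotients of [phi] at [s] are those of [f] at [s *: e + x] along [e], so the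
     mean value theorem in one variable applies. *)
  have E : (fun h : R => h^-1 *: (phi (h *: 1 + s) - phi s)) =
      (fun h : R => h^-1 *: (f (h *: e + (s *: e + x)) - f (s *: e + x))).
    by apply/funext => h; rewrite /phi [h *: 1]mulr1 scalerDl addrA.
  by split; [rewrite /derivable E; exact: df|rewrite /derive E].
have cphi : {within `[0, t], continuous phi}.
  by apply: derivable_within_continuous => s _.
have [s _] := MVT t0 (fun s _ => dphi s) cphi.
rewrite /phi scale0r add0r subr0 [t *: _ + x]addrC => ->.
by rewrite normrM (gtr0_norm t0) ler_wpM2r// ltW.
Qed.

Lemma partial_eq0 f (i : 'I_n) x : (\forall y \near x, f y = 0) ->
  partial i f x = 0.
Proof.
by move=> f0; rewrite /partial (near_eq_derive _ f0)// derive_cst.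
Qed.

Lemma continuous_translate h : continuous (fun x : 'rV[R]_n => x + h).
Proof.
move=> x.
have cid : {for x, continuous (@id 'rV[R]_n)} by exact: cvg_id.
have ccst : {for x, continuous (cst h : 'rV[R]_n -> 'rV[R]_n)}.
  exact: cst_continuous.
exact: continuousD cid ccst.
Qed.

(** The difference quotients [q k] have integral zero by translation invariance and converge
    pointwise to the partial derivative. They are dominated by [M] on a fixed ball, so the limit
    also has integral zero. *)
Lemma integral_partial0 f (i : 'I_n) (M N : R) : continuous f ->
  (forall y, derivable f y (delta_mx 0 i)) -> continuous (partial i f) ->
  (forall x, `|f x| <= M) -> (forall x, `|partial i f x| <= M) ->
  (forall x, N <= `|x| -> f x = 0) ->
  (\int[leb R n]_x (partial i f x)%:E = 0)%E.
Proof.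
move=> cf df cdf fM dfM f0; set e : 'rV[R]_n := delta_mx 0 i.
have intf := compact_support_integrable _ _ _ cf fM f0.
pose t (k : nat) : R := k.+1%:R^-1.
have t0 k : 0 < t k by rewrite invr_gt0.
have t1 k : t k <= 1 by rewrite invf_le1// ler1n.
pose q k x := (t k)^-1 * (f (x + t k *: e) - f x).
have cft k : continuous (fun x : 'rV[R]_n => f (x + t k *: e)).
  by move=> x; exact: continuous_comp (continuous_translate _ x) (cf _).
have cq k : continuous (q k).
  move=> x.
  have ccst : {for x, continuous (cst (t k)^-1 : 'rV[R]_n -> R)}.
    exact: cst_continuous.
  exact: continuousM ccst (continuousB (cft k x) (cf x)).
have qM k x : `|q k x| <= M.
  rewrite /q normrM gtr0_norm ?invr_gt0// mulrC ler_pdivrMr//.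
  exact: partial_mean_value.
(* The shift [t k *: e] has sup norm at most 1, so enlarging the radius by 1 serves all [k] at
   once. *)
have f0t k x : N + 1 <= `|x| -> f (x + t k *: e) = 0.
  move=> Nx; apply: f0; apply: le_trans (lerB_normD _ _).
  rewrite lerBrDr; apply: le_trans Nx; rewrite lerD2l normrZ gtr0_norm//.
  apply: mulr_ile1 => //; first exact: ltW.
  rewrite [leLHS]/Num.norm/= mx_normrE; apply/bigmax_leP; split => // -[j l] _.
  by rewrite /e mxE; case: (_ && _); rewrite ?normr1 ?normr0.
have f01 x : N + 1 <= `|x| -> f x = 0 by move=> Nx; apply: f0; lra.
have q0 k x : N + 1 <= `|x| -> q k x = 0.
  by move=> Nx; rewrite /q f0t// f01// subrr mulr0.
have intft k : (leb R n).-integrable (@setT lebT) (EFin \o (fun x => f (x + t k *: e))).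
  by apply: (compact_support_integrable _ M (N + 1)) => //; exact: f0t.
have intq k : (\int[leb R n]_x (q k x)%:E = 0)%E.
  under eq_integral do rewrite /q EFinM EFinB.
  rewrite integralZl//; last exact: (integrableB measurableT (intft k) intf).
  rewrite (integralB measurableT (intft k) intf).
  rewrite (integral_translate (EFin \o f) (t k *: e)).
    by rewrite subee ?mule0//; exact: integrable_fin_num.
  by apply/measurable_EFinP; exact: continuous_leb_measurable.
have oB : open (ball (0 : 'rV[R]_n) (N + 1)) by exact: ball_open.
have mB := open_leb_measurable _ oB.
pose g : lebT -> \bar R := (EFin \o cst M) \_ (ball (0 : 'rV[R]_n) (N + 1)).
have ig : (leb R n).-integrable (@setT lebT) g.
  apply: (integrable_mkcond _ mB).1.
  apply: measurable_bounded_integrable => //.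
    apply: (bounded_lebesgue_outer _ (N + 1)) => x.
    by rewrite -ball_normE/= sub0r normrN; exact: ltW.
  exists `|M|; split; [exact: num_real|move=> y My x _]; exact: ltW.
have mq k : measurable_fun (@setT lebT) (EFin \o q k).
  by apply/measurable_EFinP; exact: continuous_leb_measurable.
have mdf : measurable_fun (@setT lebT) (EFin \o partial i f).
  by apply/measurable_EFinP; exact: continuous_leb_measurable.
(* The derivative is a limit along the punctured neighborhoods of 0, so the steps must converge in
   that filter. *)
have tcvg : t k @[k --> \oo] --> (0 : R)^'.
  move=> A [/= r r0 rA].
  have /cvgrPdist_lt/(_ r r0) := @cvg_harmonic R.
  by apply: filterS => k /= kr; apply: rA => //=; rewrite gt_eqF.
have qcvg x : q k x @[k --> \oo] --> partial i f x.
  have := cvg_comp _ _ tcvg (df x).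
  rewrite (_ : _ \o _ = q ^~ x)//.
  by apply/funext => k; rewrite /q/= [x + _]addrC.
have qEcvg x : (q k x)%:E @[k --> \oo] --> (partial i f x)%:E.
  by apply: cvg_EFin; [exact: nearW|exact: qcvg].
have qg x k : (`|(q k x)%:E| <= g x)%E.
  rewrite /g /restrict; case: ifPn => [_|]; first by rewrite lee_fin.
  rewrite notin_setE -ball_normE/= sub0r normrN => /negP; rewrite -leNgt.
  by move=> /q0 ->; rewrite normr0.
have ae_cvg : {ae leb R n, forall x, [set: lebT] x ->
    (q k x)%:E @[k --> \oo] --> (partial i f x)%:E}.
  by apply: aeW => x _; exact: qEcvg.
have ae_dom : {ae leb R n, forall x k, [set: lebT] x -> (`|(q k x)%:E| <= g x)%E}.
  by apply: aeW => x k _; exact: qg.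
have [_ _] := dominated_convergence measurableT mq mdf ae_cvg ig ae_dom.
under eq_fun do rewrite intq.
by move=> /(cvg_lim (@ereal_hausdorff _)); rewrite lim_cst//.
Qed.

End integral_partial.

(** * Power inequalities on a finite measure space *)

Section powR_inequalities.
Context {R : realType}.
Implicit Types (a b p s : R).

(** Convexity of the power [p] at the points [|a|/s] and [|b|/(1-s)] with weights [s] and [1-s]; the
    weights combine with the powers of the denominators into the exponent [1-p]. *)
Lemma powR_normD_le p s a b : 1 <= p -> 0 < s < 1 ->
  `|a + b| `^ p <= s `^ (1 - p) * `|a| `^ p + (1 - s) `^ (1 - p) * `|b| `^ p.
Proof.
move=> p1 /andP[s0 s1].
have p0 : 0 <= p by rewrite (le_trans _ p1).
have t0 : 0 < 1 - s by rewrite subr_gt0.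
apply: (@le_trans _ _ ((`|a| + `|b|) `^ p)).
  by rewrite ge0_ler_powR// ?nnegrE ?addr_ge0// ler_normD.
have s01 : 0 <= s <= 1 by rewrite !ltW.
have as0 : 0 <= `|a| / s by rewrite divr_ge0// ltW.
have bt0 : 0 <= `|b| / (1 - s) by rewrite divr_ge0// ltW.
have conv : (s * (`|a| / s) + (1 - s) * (`|b| / (1 - s))) `^ p <=
    s * (`|a| / s) `^ p + (1 - s) * (`|b| / (1 - s)) `^ p.
  have := @convex_powR R p p1 (Itv01 (ltW s0) (ltW s1)) (`|a| / s) (`|b| / (1 - s)).
  by rewrite !inE/= !in_itv/= as0 bt0; exact.
move: conv.
have scale c x : 0 < c -> 0 <= x -> c * (x / c) `^ p = c `^ (1 - p) * x `^ p.
  move=> c0 x0; rewrite powRM ?invr_ge0 ?(ltW c0)//.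
  rewrite -(powR_inv1 (ltW c0)) -powRrM mulN1r powRD; last by rewrite (gt_eqF c0) implybT.
  by rewrite (powRr1 (ltW c0)); ring.
by rewrite !scale// [s * _]mulrC divfK ?gt_eqF// [(1 - s) * _]mulrC divfK ?gt_eqF.
Qed.

(** This yields the inclusion of [L^p] in [L^1] on a set of finite measure. *)
Lemma ler_norm1_powR p a : 1 < p -> `|a| <= 1 + `|a| `^ p.
Proof.
move=> p1; have [a1|/ltW a1] := leP `|a| 1; first by rewrite ler_wpDr// powR_ge0.
by rewrite ler_wpDl// le1r_powR// ltW.
Qed.

(* Young's inequality for [`|a|] and [`|c| `^ (p - 1)]. *)
Lemma powR_tangent_le p a c : 1 < p ->
  `|c| `^ p + p * (Num.sg c * `|c| `^ (p - 1)) * (a - c) <= `|a| `^ p.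
Proof.
move=> p1; have p0 : 0 < p by lra.
have q0 : 0 < p - 1 by lra.
have pq : p^-1 + (p / (p - 1))^-1 = 1.
  by rewrite invf_div -{1}(div1r p) -mulrDl subrKC mulfV// gt_eqF.
have := conjugate_powR (normr_ge0 a) (powR_ge0 `|c| (p - 1)) p0 (divr_gt0 p0 q0) pq.
rewrite -powRrM mulrCA mulfV ?gt_eqF// mulr1 => young.
have cc : Num.sg c * `|c| `^ (p - 1) * c = `|c| `^ p.
  by rewrite mulrAC -normrEsg mulr_powRB1.
have ac : Num.sg c * `|c| `^ (p - 1) * a <= `|a| * `|c| `^ (p - 1).
  rewrite mulrAC ler_wpM2r ?powR_ge0//.
  by rewrite (le_trans (ler_norm _))// normrM ler_piMl// normr_sg; case: eqP.
set k := Num.sg c * _ in cc ac *.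
have := ler_wpM2l (ltW p0) (le_trans ac young).
rewrite [X in _ <= X](_ : _ = `|a| `^ p + (p - 1) * `|c| `^ p).
  by move=> ?; rewrite mulrBr -[p * k * c]mulrA cc; lra.
by field; rewrite !gt_eqF.
Qed.

End powR_inequalities.

Section finite_measure_Lp.
Context d (T : measurableType d) (R : realType).
Variables (mu : {measure set T -> \bar R}) (D : set T).
Hypotheses (mD : measurable D) (Dfin : (mu D < +oo)%E).
Implicit Types (f : T -> R) (p s c : R).

Lemma measurable_normr_powR p f : measurable_fun D f ->
  measurable_fun D (fun x => (`|f x| `^ p)%:E).
Proof.
move=> mf; apply/measurable_EFinP.
apply: (measurableT_comp (measurable_powR p)).
exact: measurableT_comp.
Qed.

Lemma integral_powR_ge0 p f :
  (0 <= \int[mu]_(x in D) (`|f x| `^ p)%:E)%E.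
Proof. by apply: integral_ge0 => x _; rewrite lee_fin powR_ge0. Qed.

Lemma integral_powR_eq0 p f : 0 < p -> measurable_fun D f ->
  (\int[mu]_(x in D) (`|f x| `^ p)%:E)%E = 0%E <->
  {ae mu, forall x, D x -> f x = 0}.
Proof.
move=> p0 mf; have mfp := measurable_normr_powR p _ mf.
have powE x : (`|(`|f x| `^ p)%:E| = (`|f x| `^ p)%:E)%E.
  by rewrite gee0_abs// lee_fin powR_ge0.
under eq_integral do rewrite -powE.
rewrite (ae_eq_integral_abs mu mD mfp).
split; apply: filterS => x /= fx Dx.
  by have [/powR_eq0_eq0/normr0_eq0] := fx Dx.
by rewrite fx// normr0 powR0// gt_eqF.
Qed.

Lemma Lp_on_integrable p f : 1 < p -> Lp_on mu D p f ->
  mu.-integrable D (EFin \o f).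
Proof.
move=> p1 [mf ffin]; apply/integrableP; split; first exact/measurable_EFinP.
apply: (@le_lt_trans _ _ (\int[mu]_(x in D) (1 + (`|f x| `^ p)%:E))%E).
  apply: ge0_le_integral => //.
  - by apply: measurableT_comp => //; exact/measurable_EFinP.
  - by have := measurable_normr_powR p _ mf; exact: emeasurable_funD (measurable_cst _).
  - by move=> x _; rewrite -EFinD lee_fin ler_norm1_powR.
rewrite ge0_integralD//; last exact: measurable_normr_powR.
by rewrite integral_cst// mul1e lte_add_pinfty.
Qed.

Lemma integral_powR_addr_le p s f c : 1 <= p -> 0 < s < 1 -> measurable_fun D f ->
  (\int[mu]_(x in D) (`|f x + c| `^ p)%:E <=
   (s `^ (1 - p))%:E * \int[mu]_(x in D) (`|f x| `^ p)%:E
   + ((1 - s) `^ (1 - p) * `|c| `^ p)%:E * mu D)%E.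
Proof.
move=> p1 s01 mf.
rewrite -integral_cst// -ge0_integralZl//; last 2 first.
- exact: measurable_normr_powR.
- by rewrite lee_fin powR_ge0.
rewrite -ge0_integralD//; last 3 first.
- by move=> x _; rewrite mule_ge0// lee_fin powR_ge0.
- by apply: measurable_funeM; exact: measurable_normr_powR.
- by move=> x _; rewrite lee_fin mulr_ge0 ?powR_ge0.
apply: ge0_le_integral => //.
- by apply: measurable_normr_powR; exact: measurable_funD.
- have := measurable_funeM (s `^ (1 - p))%:E (measurable_normr_powR p _ mf).
  by move=> /emeasurable_funD; apply; exact: measurable_cst.
- by move=> x _; rewrite -EFinM -EFinD lee_fin; exact: powR_normD_le.
Qed.

Lemma Lp_on_subr p f c : 1 < p -> Lp_on mu D p f ->
  Lp_on mu D p (fun x => f x - c).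
Proof.
move=> p1 [mf ffin]; split; first exact: measurable_funB.
(* Only finiteness is at stake, so the weight is chosen arbitrarily. *)
have h01 : 0 < (2^-1 : R) < 1 by lra.
apply: le_lt_trans (integral_powR_addr_le _ (2^-1) _ (- c) (ltW p1) h01 mf) _.
rewrite lte_add_pinfty// lte_mul_pinfty// ?lee_fin ?mulr_ge0 ?powR_ge0//.
Qed.

(** Jensen's inequality: the tangent inequality at the mean [c] is integrated, and its linear term
    contributes nothing since [f - c] has integral zero. *)
Lemma integral_powR_ge_mean p f : 1 < p -> (0 < mu D)%E -> Lp_on mu D p f ->
  let c := fine (\int[mu]_(x in D) (f x)%:E) / fine (mu D) in
  ((`|c| `^ p)%:E * mu D <= \int[mu]_(x in D) (`|f x| `^ p)%:E)%E.
Proof.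
move=> p1 D0 Lf /=; have intf := Lp_on_integrable _ _ p1 Lf.
have [mf ffin] := Lf.
have muD : mu D \is a fin_num by rewrite ge0_fin_numE.
have D0' : 0 < fine (mu D) by rewrite fine_gt0// D0 ltey_eq muD.
set I := fine _; set c := _ / _.
have Ie : (\int[mu]_(x in D) (f x)%:E = I%:E)%E.
  by rewrite /I fineK//; exact: integrable_fin_num.
(* The tangent at [c] to the power function is [A + B * y]. *)
pose B := p * (Num.sg c * `|c| `^ (p - 1)); pose A := `|c| `^ p - B * c.
have intA : mu.-integrable D (EFin \o cst A).
  apply: measurable_bounded_integrable => //.
  by exists `|A|; split => // y Ay x _ /=; exact: ltW.
have intB : mu.-integrable D (fun x => B%:E * (f x)%:E)%E.
  exact: integrableZl.
have intp : mu.-integrable D (fun x => (`|f x| `^ p)%:E).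
  apply/integrableP; split; first exact: measurable_normr_powR.
  by under eq_integral do rewrite gee0_abs ?lee_fin ?powR_ge0//.
apply: (@le_trans _ _ (\int[mu]_(x in D) (A%:E + B%:E * (f x)%:E))%E); last first.
  apply: le_integral => //; first exact: integrableD.
  move=> x _; rewrite -EFinM -EFinD lee_fin /A.
  by have := powR_tangent_le p (f x) c p1; rewrite -/B mulrBr; lra.
rewrite integralD// integral_cst// integralZl// Ie -(fineK muD) -!EFinM -EFinD lee_fin.
by rewrite le_eqVlt; apply/orP; left; apply/eqP; rewrite /A /c; field; rewrite gt_eqF.
Qed.

End finite_measure_Lp.

(** * Subtracting a constant from a Sobolev function *)

Section shift.
Context {R : realType} {n : nat}.
Implicit Types (Omega : set 'rV[R]_n) (u g f : 'rV[R]_n -> R)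
  (Du : 'rV[R]_n -> 'rV[R]_n) (p c : R).
Let lebT : measurableType _ := caratheodory_type (lebesgue_outer R n).

Lemma compact_support_bounded f (K : set 'rV[R]_n) :
  compact K -> continuous f -> (forall x, ~ K x -> f x = 0) ->
  exists M : R, forall x, `|f x| <= M.
Proof.
move=> cK cf f0.
have /compact_bounded[M [_ /(_ (M + 1))]] : compact (f @` K).
  by apply: continuous_compact => //; exact: continuous_subspaceT.
(* The maximum with 0 covers the points outside [K], since [M + 1] may be negative when [K] is
   empty. *)
rewrite ltrDl ltr01 => /(_ isT) fM; exists (Num.max (M + 1) 0) => x.
rewrite le_max; have [Kx|nKx] := pselect (K x).
  by rewrite fM//; exists x.
by rewrite f0// normr0 lexx orbT.
Qed.

Lemma partial_eq0_notin_support f (i : 'I_n) x :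
  ~ closure [set y | f y != 0] x -> partial i f x = 0.
Proof.
move=> nKx; apply: partial_eq0.
have : nbhs x (~` closure [set y | f y != 0]).
  by apply: open_nbhs_nbhs; split => //; apply: closed_openC; exact: closed_closure.
apply: filterS => y nKy; apply/eqP/negPn/negP => fy.
by apply: nKy; exact: subset_closure.
Qed.

Lemma test_function_partial_continuous Omega f (i : 'I_n) :
  test_function Omega f -> continuous (partial i f).
Proof. by move=> [sf _ _]; have [] := sf [:: i]. Qed.

Lemma test_function_partial_bounded Omega f (i : 'I_n) :
  test_function Omega f -> exists M : R, forall x, `|partial i f x| <= M.
Proof.
move=> tf; have [_ cK _] := tf; apply: (compact_support_bounded _ _ cK).
  exact: test_function_partial_continuous tf.
by move=> x; exact: partial_eq0_notin_support.
Qed.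

(** The partial derivative vanishes off the support, which lies in [Omega], so the integral equals
    the one over the whole space. *)
Lemma integral_test_function_partial Omega f (i : 'I_n) :
  test_function Omega f ->
  (\int[leb R n]_(x in Omega) (partial i f x)%:E = 0)%E.
Proof.
move=> tf; have [sf cK KO] := tf.
have [cf df] : continuous f /\ (forall j x, derivable f x (delta_mx 0 j)) := sf [::].
have f0 x : ~ closure [set y | f y != 0] x -> f x = 0.
  move=> nKx; apply/eqP/negPn/negP => fx.
  by apply: nKx; exact: subset_closure.
have [M1 fM] := compact_support_bounded _ _ cK cf f0.
have [M2 dfM] := test_function_partial_bounded _ _ i tf.
have [N [_ /(_ (N + 1))]] := compact_bounded cK.
rewrite ltrDl ltr01 => /(_ isT) KN.
rewrite integral_mkcond -[RHS](@integral_partial0 R n f i (Num.max M1 M2) (N + 2))//.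
- apply: eq_integral => x _; rewrite /restrict; case: ifPn => //.
  rewrite notin_setE => nOx; rewrite partial_eq0_notin_support//.
  exact: contra_not (KO x) nOx.
- exact: test_function_partial_continuous tf.
- by move=> x; rewrite le_max fM.
- by move=> x; rewrite le_max dfM orbT.
- move=> x Nx; apply: f0 => Kx; have := KN x Kx; rewrite /=; lra.
Qed.

Variables (p : R) (Omega : set 'rV[R]_n).
Hypotheses (p1 : 1 < p) (oO : open Omega) (Ofin : (leb R n Omega < +oo)%E).

Let mO : measurable (Omega : set lebT).
Proof. exact: open_leb_measurable. Qed.

(** The extra term is [c] times the integral of [partial i f], which is zero. Splitting it off
    requires integrability: [u] is in [L^1] and [partial i f] is bounded. *)
Lemma weak_gradient_subr u Du c : Lp_on (leb R n) Omega p u ->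
  weak_gradient Omega u Du -> weak_gradient Omega (fun x => u x - c) Du.
Proof.
move=> Lu wu f tf i; rewrite -wu//.
have [M dfM] := test_function_partial_bounded _ _ i tf.
have intu := Lp_on_integrable _ _ _ _ _ mO Ofin _ _ p1 Lu.
have mdf : measurable_fun (Omega : set lebT) (partial i f : lebT -> R).
  apply/measurable_funTS/continuous_leb_measurable.
  exact: test_function_partial_continuous tf.
have intdf : (leb R n).-integrable Omega (EFin \o partial i f).
  apply: measurable_bounded_integrable => //.
  exists M; split; first exact: num_real.
  by move=> y My x _ /=; apply: le_trans (dfM x) (ltW My).
have intudf : (leb R n).-integrable Omega (fun x => (u x * partial i f x)%:E).
  apply: (@le_integrable _ _ _ _ _ mO _ (fun x => M%:E * (u x)%:E)%E);
    last exact: integrableZl.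
    by apply/measurable_EFinP; apply: measurable_funM => //; case: Lu.
  move=> x _; rewrite -EFinM lee_fin !normrM mulrC ler_wpM2r//.
  by apply: le_trans (dfM x) (ler_norm _).
under eq_integral do rewrite mulrBl EFinB [(c * _)%:E]EFinM.
rewrite (integralB mO intudf (integrableZl mO c intdf)) (integralZl mO intdf).
by rewrite (integral_test_function_partial _ _ _ tf) mule0 sube0.
Qed.

Lemma partial_subr f (i : 'I_n) c : partial i (fun x => f x - c) = partial i f.
Proof.
apply/funext => x; rewrite /partial /derive.
suff -> : (fun h : R => h^-1 *:
      (((fun y => f y - c) \o shift x) (h *: delta_mx 0 i) - (f x - c))) =
    (fun h => h^-1 *: ((f \o shift x) (h *: delta_mx 0 i) - f x)) by [].
by apply/funext => h /=; rewrite opprB addrA subrK.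
Qed.

Lemma smooth_subr f c : smooth f -> smooth (fun x => f x - c).
Proof.
move=> sf s.
(* A single derivative removes the constant, so for nonempty [s] the iterated derivatives
   coincide. *)
have [->|s0] := eqVneq s [::].
  have [cf df] : continuous f /\ (forall j x, derivable f x (delta_mx 0 j)) := sf [::].
  split=> [x|i x] /=.
    have ccst : {for x, continuous (cst c : 'rV[R]_n -> R)} by exact: cst_continuous.
    exact: continuousB (cf x) ccst.
  exact: derivableB.
have -> : foldr partial (fun x => f x - c) s = foldr partial f s; last exact: sf.
elim: s s0 => // i [|j s] IH _ /=; first by rewrite partial_subr.
by congr partial; exact: IH.
Qed.

Lemma W1p_subr u Du c : W1p Omega p u Du -> W1p Omega p (fun x => u x - c) Du.
Proof.
move=> [Lu LDu wu]; split => //; first exact: Lp_on_subr.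
exact: weak_gradient_subr.
Qed.

Let surfT : measurableType _ := caratheodory_type (@hausdorff_outer R n n.-1).

Lemma closed_boundary (A : set 'rV[R]_n) : closed (boundary A).
Proof.
rewrite /boundary setDE; apply: closedI; first exact: closed_closure.
by apply: open_closedC; exact: open_interior.
Qed.

Lemma boundary_measurable : measurable (boundary Omega : set surfT).
Proof. by apply: closed_hausdorff_measurable; exact: closed_boundary. Qed.

(** The shifted sequence [v k - c] works: the differences with [u - c] and [g - c], and the
    gradients, are the same as before. *)
Lemma trace_subr u Du g c : (@surf R n (boundary Omega) < +oo)%E ->
  trace Omega p u Du g ->
  trace Omega p (fun x => u x - c) Du (fun x => g x - c).
Proof.
move=> Sfin [Lg [v [sv vu Dv vg]]]; split.
  by apply: Lp_on_subr => //; exact: boundary_measurable.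
exists (fun k x => v k x - c); split.
- by move=> k; exact: smooth_subr.
- by under eq_fun do under eq_integral do rewrite opprB addrA subrK.
- have gradE k : grad (fun x => v k x - c) = grad (v k).
    by apply/funext => x; apply/rowP => i; rewrite !mxE partial_subr.
  by under eq_fun do rewrite gradE.
- by under eq_fun do under eq_integral do rewrite opprB addrA subrK.
Qed.

End shift.

(** * The explicit constants *)

Section real_bounds.
Context {R : realType}.
Implicit Types (p x t a b c k alpha C S V : R).

(* The weights of the convexity inequality that balance the interior and the
   boundary terms. *)
Lemma optimal_weights p x t : 1 < p -> 0 < x -> t = x `^ (1 / (p - 1)) ->
  let s := t / (1 + t) in
  [/\ 0 < s < 1, (1 + t) `^ (1 - p) * s `^ (1 - p) * x = 1 &
      (1 + t) `^ (1 - p) * (1 - s) `^ (1 - p) = 1].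
Proof.
move=> p1 x0 tE s.
have t0 : 0 < t by rewrite tE powR_gt0.
have t10 : 0 < 1 + t by rewrite addr_gt0.
have s0 : 0 < s by rewrite divr_gt0.
have s1 : 1 - s = (1 + t)^-1 by rewrite /s; field; rewrite gt_eqF.
have s1' : 0 < 1 - s by rewrite s1 invr_gt0.
have inv1t a : 0 < a -> a `^ (1 - p) * a^-1 `^ (1 - p) = 1.
  by move=> a0; rewrite -powRM ?invr_ge0 ?ltW// mulfV ?powR1// gt_eqF.
split; first by rewrite s0 -subr_gt0.
(* As [(1 + t) * s = t], the two powers multiply to [t^(1-p)], the inverse of [x]. *)
- rewrite -powRM ?ltW// /s mulrCA mulfV ?gt_eqF// mulr1 tE -powRrM.
  have -> : 1 / (p - 1) * (1 - p) = -1 by field; lra.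
  by rewrite powR_inv1 ?ltW// mulVf ?gt_eqF.
- by rewrite s1 inv1t.
Qed.

(** Write the power as the exponential of [(1-p) ln(1+t)] and use [1 + y <= exp y], then
    [ln(1+t) <= t]. *)
Lemma bernoulli_powR p t : 1 < p -> 0 < t -> 1 - (p - 1) * t <= (1 + t) `^ (1 - p).
Proof.
move=> p1 t0.
have t10 : 0 < 1 + t by rewrite addr_gt0.
rewrite /powR gt_eqF//; apply: le_trans (expR_ge1Dx _).
rewrite lerD2l -mulNr opprB -subr_ge0.
have : ln (1 + t) <= t by apply: le_ln1Dx; lra.
by nra.
Qed.

(** [k] and [den] stand for the extra factor and the denominator in (i) and (ii). After Bernoulli's
    inequality the claim compares two roots, and reduces to [1/V <= k/den]. *)
Lemma stated_bound_le p k den alpha C S V t : 1 < p -> 0 < alpha -> 0 < C ->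
  0 < S -> 0 < V -> 1 <= k -> 0 < den <= V ->
  t = (alpha * C * S / V) `^ (1 / (p - 1)) ->
  1 - alpha `^ (1 / (p - 1)) *
    (C * S * (p - 1) `^ (p - 1) * k / den) `^ (1 / (p - 1)) <= (1 + t) `^ (1 - p).
Proof.
move=> p1 a0 C0 S0 V0 k1 /andP[d0 dV] tE.
have q0 : 0 < p - 1 by lra.
have x0 : 0 < alpha * C * S / V by rewrite divr_gt0 ?mulr_gt0.
apply: le_trans (bernoulli_powR _ _ p1 _); last by rewrite tE powR_gt0.
rewrite lerD2l lerN2.
have -> : (p - 1) * t =
    ((p - 1) `^ (p - 1) * (alpha * C * S / V)) `^ (1 / (p - 1)).
  rewrite powRM ?powR_ge0 ?(ltW x0)// -powRrM -tE mulrCA mulfV ?gt_eqF// mulr1.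
  by rewrite powRr1 ?ltW.
have Q0 : 0 < (p - 1) `^ (p - 1) by rewrite powR_gt0.
set Q := _ `^ (p - 1) in Q0 *.
have k0 : 0 < k by lra.
have Z0 : 0 <= C * S * Q * k / den by rewrite divr_ge0 ?mulr_ge0// ltW.
have kd : V^-1 <= k / den.
  by rewrite ler_pdivlMr// mulrC ler_pdivrMr//; nra.
have le : Q * (alpha * C * S / V) <= alpha * (C * S * Q * k / den).
  have -> : alpha * (C * S * Q * k / den) = Q * (alpha * C * S) * (k / den).
    by ring.
  by rewrite mulrA ler_wpM2l// !mulr_ge0// ltW.
rewrite -powRM ?(ltW a0)// ge0_ler_powR ?nnegrE// ?divr_ge0 ?(ltW q0)//.
- by rewrite mulr_ge0// ltW.
- by rewrite mulr_ge0// ltW.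
Qed.

Lemma stated_bound2_le x q : 0 < q -> x = (1 + q)^-1 ->
  1 - (2 + q - Num.sqrt q * Num.sqrt (4 + q)) / 2 <= (1 + x)^-1.
Proof.
move=> q0 ->.
have -> : (1 + (1 + q)^-1)^-1 = (1 + q) / (2 + q) by field; rewrite !gt_eqF//; lra.
have q2 : 0 < 2 + q by lra.
have q1 : 0 < 1 + q by lra.
rewrite -sqrtrM ?(ltW q0)//.
suff : Num.sqrt (q * (4 + q)) <= q + 2 * ((1 + q) / (2 + q)) by lra.
have y0 : 0 < (1 + q) / (2 + q) by rewrite divr_gt0.
rewrite -[leRHS]ger0_norm -?sqrtr_sqr ?ler_wsqrtr//; last by lra.
have yE : (2 + q) * ((1 + q) / (2 + q)) = 1 + q by field; rewrite gt_eqF.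
set y := _ / _ in y0 yE *.
have yq : q <= y * (1 + q) by rewrite -(ler_pM2l q2); nra.
(* The squares are compared after multiplication by [2 + q], so that [yE] clears the denominators;
   what remains is [4 * (y * (1 + q) - q)], nonnegative by [yq]. *)
rewrite -subr_ge0 -(pmulr_rge0 _ q2).
have -> : (2 + q) * ((q + 2 * y) ^+ 2 - q * (4 + q)) =
   4 * (q * ((2 + q) * y) + y * ((2 + q) * y) - q * (2 + q)) by ring.
by rewrite yE; nra.
Qed.

End real_bounds.

(** * Lower bound on the eigenvalue *)

Section lower_bound.
Context {R : realType} {n : nat}.
Implicit Types (p alpha : R).
Let lebT : measurableType _ := caratheodory_type (lebesgue_outer R n).

Lemma fine_gt0_EFin (x : \bar R) : 0 < fine x -> x = (fine x)%:E.
Proof. by case: x => //=; rewrite ltxx. Qed.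

Lemma C2_ge (Omega : set 'rV[R]_n) p w Dw g : 1 < p -> open Omega ->
  0 < C2 Omega p -> W1p_trace Omega p w Dw g ->
  (\int[surf]_(x in boundary Omega) (g x)%:E = 0)%E ->
  (\int[leb R n]_(x in Omega) (`|w x| `^ p)%:E <=
   (C2 Omega p)%:E * \int[leb R n]_(x in Omega) (enorm (Dw x) `^ p)%:E)%E.
Proof.
move=> p1 oO C0 wDwg g0; have [[[mw wfin] _ _] _] := wDwg.
have mO : measurable (Omega : set lebT) by exact: open_leb_measurable.
have p0 : 0 < p by lra.
set W := (\int[leb R n]_(x in Omega) (`|w x| `^ p)%:E)%E.
set D := (\int[leb R n]_(x in Omega) (enorm (Dw x) `^ p)%:E)%E.
have D0 : (0 <= D)%E by apply: integral_ge0 => x _; rewrite lee_fin powR_ge0.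
have W0 : (0 <= W)%E by exact: integral_powR_ge0.
(* A function vanishing almost everywhere is excluded from the supremum, but satisfies the
   inequality trivially. *)
have [w0|nzw] := pselect {ae leb R n, forall x, Omega x -> w x = 0}.
  have -> : W = 0%E by apply/(integral_powR_eq0 _ _ _ _ _ mO _ _ p0 mw).
  by rewrite mule_ge0// lee_fin ltW.
have Wgt0 : (0 < W)%E.
  rewrite lt_neqAle W0 andbT eq_sym; apply/eqP => WE; apply: nzw.
  by apply/(integral_powR_eq0 _ _ _ _ _ mO _ _ p0 mw).
(* [fine] sends both infinities to 0, so positivity of [C2] means that the supremum is finite. *)
have CE : C2e Omega p = (C2 Omega p)%:E by exact: fine_gt0_EFin.
have WD : (W / D <= (C2 Omega p)%:E)%E.
  by rewrite -CE; apply: ereal_sup_ubound; exists w, Dw, g.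
move: WD D0; rewrite -/D; case: D => [d| |] WD // D0; last first.
  by rewrite gt0_muley ?lte_fin// leey.
(* If the gradient integral were zero, the quotient would be [+oo], since [W > 0]; this contradicts
   the finite supremum. *)
move: D0; rewrite lee_fin le_eqVlt => /predU1P[d0|d0].
  by move: WD; rewrite -d0 inve0 gt0_muley// leye_eq.
by move: WD; rewrite inver gt_eqF// lee_pdivrMr.
Qed.

Lemma lambda1_ge (Omega : set 'rV[R]_n) p alpha t : open Omega -> 1 < p ->
  0 < alpha -> 0 < C2 Omega p -> 0 < volume Omega -> 0 < perimeter Omega ->
  t = (alpha * C2 Omega p * perimeter Omega / volume Omega) `^ (1 / (p - 1)) ->
  ((alpha * (perimeter Omega / volume Omega) * (1 + t) `^ (1 - p))%:E
   <= lambda1 alpha p Omega)%E.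
Proof.
move=> oO p1 a0 C0 V0 S0 tE.
set C := C2 Omega p in C0 tE *; set V := volume Omega in V0 tE *.
set S := perimeter Omega in S0 tE *.
have mO : measurable (Omega : set lebT) by exact: open_leb_measurable.
have mB := boundary_measurable Omega.
have p0 : 0 < p by lra.
have VE : leb R n Omega = V%:E by exact: fine_gt0_EFin.
have SE : surf (boundary Omega) = S%:E by exact: fine_gt0_EFin.
have Vfin : (leb R n Omega < +oo)%E by rewrite VE ltry.
have Sfin : (@surf R n (boundary Omega) < +oo)%E by rewrite SE ltry.
have x0 : 0 < alpha * C * S / V by rewrite divr_gt0 ?mulr_gt0.
have [s01 wC wV] := optimal_weights _ _ _ p1 x0 tE.
set s := t / (1 + t) in s01 wC wV.
set b := (1 + t) `^ (1 - p) in wC wV *.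
apply: le_ereal_inf_tmp => _ [u [Du [g [uDug nzu ->]]]].
have [[[mu ufin] LDu wu] [Lg trg]] := uDug.
set U := (\int[leb R n]_(x in Omega) (`|u x| `^ p)%:E)%E.
have U0 : (0 <= U)%E by exact: integral_powR_ge0.
have : U != 0%E.
  by apply/eqP => UE; apply: nzu; apply/(integral_powR_eq0 _ _ _ _ _ mO _ _ p0 mu).
have : U \is a fin_num by rewrite ge0_fin_numE.
case Ur : U => [r| |]//= _; rewrite eqe => rn0.
have r0 : 0 < r by rewrite lt_neqAle eq_sym rn0 -lee_fin -Ur.
rewrite inver gt_eqF// lee_pdivlMr//.
set G := (\int[surf]_(x in boundary Omega) (`|g x| `^ p)%:E)%E.
have G0 : (0 <= G)%E by exact: integral_powR_ge0.
have Gfin : G \is a fin_num by rewrite ge0_fin_numE//; case: Lg.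
set D := (\int[leb R n]_(x in Omega) (enorm (Du x) `^ p)%:E)%E.
have D0 : (0 <= D)%E by apply: integral_ge0 => x _; rewrite lee_fin powR_ge0.
pose I := fine (\int[surf]_(x in boundary Omega) (g x)%:E).
pose c := I / S.
have intg := Lp_on_integrable _ _ _ _ _ mB Sfin _ _ p1 Lg.
have IE : (\int[surf]_(x in boundary Omega) (g x)%:E = I%:E)%E.
  by rewrite /I fineK//; exact: integrable_fin_num.
have jensen : ((`|c| `^ p * S)%:E <= G)%E.
  have Bgt0 : (0 < @surf R n (boundary Omega))%E by rewrite SE lte_fin.
  have : ((`|c| `^ p)%:E * surf (boundary Omega) <= G)%E :=
    integral_powR_ge_mean _ _ _ _ _ mB Sfin _ _ p1 Bgt0 Lg.
  by rewrite SE.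
have mean0 : (\int[surf]_(x in boundary Omega) (g x - c)%:E = 0)%E.
  under eq_integral do rewrite EFinB.
  have intc : surf.-integrable (boundary Omega) (cst c%:E).
    apply: measurable_bounded_integrable => //.
    by exists `|c|; split => // y cy x _ /=; exact: ltW.
  have cstE : (\int[surf]_(x in boundary Omega) (cst c%:E) x =
      c%:E * surf (boundary Omega))%E by exact: integral_cst.
  rewrite (integralB mB intg intc) IE cstE SE -EFinM -EFinB.
  by rewrite /c divfK ?subrr// gt_eqF.
have wDwg : W1p_trace Omega p (fun x => u x - c) Du (fun x => g x - c).
  split; first by apply: W1p_subr => //; case: uDug.
  by apply: trace_subr => //; case: uDug.
have := C2_ge _ _ _ _ _ p1 oO C0 wDwg mean0; rewrite -/D.
set W := (\int[leb R n]_(x in Omega) (`|u x - c| `^ p)%:E)%E => WCD.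
have UW : (U <= (s `^ (1 - p))%:E * W + ((1 - s) `^ (1 - p) * `|c| `^ p * V)%:E)%E.
  have mw : measurable_fun (Omega : set lebT) (fun x => u x - c).
    exact: measurable_funB.
  have : (\int[leb R n]_(x in Omega) (`|u x - c + c| `^ p)%:E <=
      (s `^ (1 - p))%:E * W + ((1 - s) `^ (1 - p) * `|c| `^ p)%:E * leb R n Omega)%E :=
    integral_powR_addr_le _ _ _ _ _ mO p s (fun x => u x - c) c (ltW p1) s01 mw.
  by rewrite VE -EFinM; under eq_integral do rewrite subrK.
(* An infinite gradient integral makes the right-hand side [+oo]. Otherwise [W] is finite and the
   rest is an inequality between reals. *)
move: D0 WCD; case: D => [d| |] D0 WCD//; last first.
  by rewrite addye ?leey// gt_eqF// (lt_le_trans (ltNyr 0))// mule_ge0// lee_fin ltW.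
have W0 : (0 <= W)%E by exact: integral_powR_ge0.
have Wfin : W \is a fin_num.
  by rewrite ge0_fin_numE// (le_lt_trans WCD)// -EFinM ltry.
move: jensen UW; rewrite Ur -(fineK Gfin) -(fineK Wfin) -!EFinM -!EFinD !lee_fin.
move: WCD; rewrite -(fineK Wfin) -EFinM lee_fin.
set w := fine W; set e := `|c| `^ p; set k := fine G.
set s1 := s `^ _ in wC *; set s2 := (1 - s) `^ _ in wV * => wd eG rw.
have aSV : 0 < alpha * (S / V) * b.
  by rewrite !mulr_gt0 ?invr_gt0// powR_gt0// addr_gt0// tE powR_gt0.
(* By the choice of weights the coefficient of [w] is [1/C], so that term is at most [d]; the other
   one becomes [alpha * (e * S)], at most [alpha * k] by Jensen. *)
have s1C : alpha * (S / V) * b * s1 = C^-1.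
  by apply: (mulIf (lt0r_neq0 C0)); rewrite mulVf ?gt_eqF// -[RHS]wC; ring.
apply: le_trans (ler_wpM2l (ltW aSV) rw) _.
have -> : alpha * (S / V) * b * (s1 * w + s2 * e * V) =
    (alpha * (S / V) * b * s1) * w + (b * s2) * (alpha * (e * S)).
  by field; rewrite gt_eqF.
rewrite s1C wV mul1r lerD//; last by rewrite ler_wpM2l// ltW.
by rewrite mulrC ler_pdivrMr// mulrC.
Qed.

Lemma volume_ge0 (Omega : set 'rV[R]_n) : 0 <= volume Omega.
Proof. by rewrite fine_ge0// measure_ge0. Qed.

Lemma perimeter_ge0 (Omega : set 'rV[R]_n) : 0 <= perimeter Omega.
Proof. by rewrite fine_ge0// measure_ge0. Qed.

Lemma C2_ge0 (Omega : set 'rV[R]_n) p : 0 <= C2 Omega p.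
Proof.
rewrite /C2 /C2e; set A := [set _ | _].
(* Without admissible functions the supremum is [-oo], which [fine] sends to 0. *)
have [->|/set0P[l Al]] := eqVneq A set0; first by rewrite ereal_sup0.
apply: fine_ge0; apply: le_trans (ereal_sup_ubound Al).
case: Al => w [Dw [g [_ _ _ ->]]].
have int0 (h : 'rV[R]_n -> R) : (forall x, 0 <= h x) ->
    (0 <= \int[leb R n]_(x in Omega) (h x)%:E)%E.
  by move=> h0; apply: integral_ge0 => x _; rewrite lee_fin.
by rewrite mule_ge0 ?inve_ge0// int0// => x; exact: powR_ge0.
Qed.

End lower_bound.

(** * The explicit bounds *)

Lemma divr_gt0_factors {R : realType} (a b c : R) :
  0 <= a -> 0 <= b -> 0 <= c -> 0 < a / (b * c) -> [/\ 0 < a, 0 < b & 0 < c].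
Proof.
rewrite !le_eqVlt => /predU1P[<-|a0]; first by rewrite mul0r ltxx.
move=> /predU1P[<-|b0]; first by rewrite mul0r invr0 mulr0 ltxx.
by move=> /predU1P[<-|c0]; first by rewrite mulr0 invr0 mulr0 ltxx.
Qed.

(* [C2], the volume and the perimeter may be the junk value [0] of [fine +oo]; the range
   of [alpha] is then empty, as [x / 0 = 0]. *)
Lemma lambda1_ge_explicit {R : realType} {n : nat} (Omega : set 'rV[R]_n)
    (p alpha k K : R) :
  let V := volume Omega in
  let S := perimeter Omega in
  let C := C2 Omega p in
  open Omega -> 1 < p -> 1 <= k -> 0 < K ->
  0 < alpha < K^-1 * V / (C * S * p) ->
  ((alpha * (S / V) *
    (1 - alpha `^ (1 / (p - 1)) *
      (C * S * (p - 1) `^ (p - 1) * k / (V - C * alpha * S * K * p))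
        `^ (1 / (p - 1))))%:E
   <= lambda1 alpha p Omega)%E.
Proof.
move=> V S C oO p1 k1 K0 /andP[a0 aV].
have p0 : 0 < p by lra.
have [KV0 CS0 _] : [/\ 0 < K^-1 * V, 0 < C * S & 0 < p].
  apply: divr_gt0_factors (lt_trans a0 aV); last exact: ltW.
    by rewrite mulr_ge0 ?invr_ge0 ?(ltW K0)// volume_ge0.
  by rewrite mulr_ge0 ?C2_ge0 ?perimeter_ge0.
have V0 : 0 < V by rewrite -(pmulr_rgt0 _ (_ : 0 < K^-1)) ?invr_gt0.
have C0 : 0 < C.
  rewrite lt_neqAle C2_ge0 andbT; apply/eqP => CE.
  by rewrite -CE mul0r ltxx in CS0.
have S0 : 0 < S by rewrite -(pmulr_rgt0 _ C0).
apply: le_trans (lambda1_ge _ _ _ _ oO p1 a0 C0 V0 S0 erefl).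
rewrite lee_fin ler_wpM2l ?mulr_ge0 ?invr_ge0 ?(ltW a0) ?(ltW S0) ?(ltW V0)//.
apply: (stated_bound_le _ _ _ _ _ _ V) => //.
(* The upper bound on [alpha] says exactly that the denominator is positive. *)
move: aV; rewrite ltr_pdivlMr ?mulr_gt0// [K^-1 * V]mulrC ltr_pdivlMr// => aV.
have pos : 0 <= C * alpha * S * K * p by rewrite !mulr_ge0// ltW.
apply/andP; split; last by rewrite gerBl.
by rewrite subr_gt0; move: aV; congr (_ < _); ring.
Qed.

Theorem theorem2p3 (R : realType) (n : nat) (n_ge2 : (2 <= n)%N)
    (Omega : set 'rV[R]_n) (Omega_lip : bounded_lipschitz_domain Omega) :
  let V := volume Omega in
  let S := perimeter Omega in
  let C := C2 Omega in
  [/\ (forall p alpha : R, 2 <= p ->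
        0 < alpha < 2 `^ (2 - p) * V / (C p * S * p) ->
        ((alpha * (S / V) *
          (1 - alpha `^ (1 / (p - 1)) *
            (C p * S * (p - 1) `^ (p - 1) * 2 `^ ((p - 2) * p) /
             (V - C p * alpha * S * 2 `^ (p - 2) * p)) `^ (1 / (p - 1))))%:E
         <= lambda1 alpha p Omega)%E),
      (forall p alpha : R, 1 < p <= 2 ->
        0 < alpha < V / (C p * S * p) ->
        ((alpha * (S / V) *
          (1 - alpha `^ (1 / (p - 1)) *
            (C p * S * (p - 1) `^ (p - 1) /
             (V - C p * alpha * S * p)) `^ (1 / (p - 1))))%:E
         <= lambda1 alpha p Omega)%E)
    & (forall alpha : R, 0 < alpha < V / (C 2 * S) ->
        let q := (V / S - alpha * C 2) / (alpha * C 2) in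
        let c := 2 + q - Num.sqrt q * Num.sqrt (4 + q) in
        ((alpha * (S / V) * (1 - c / 2))%:E <= lambda1 alpha 2 Omega)%E)].
Proof.
move=> V S C; have oO : open Omega by case: Omega_lip.
split.
(* Here [K] is [2^(p-2)] and [k] is [2^((p-2)p)], at least 1 because [p >= 2]; in (ii) both are
   1. *)
- move=> p alpha p2 alphaV; apply: (lambda1_ge_explicit _ _ _ _ (2 `^ (p - 2))) => //.
  + lra.
  + by rewrite -[leLHS](powRr0 2) ler_powR ?ler1n// mulr_ge0; lra.
  + by rewrite -powRN opprB.
- move=> p alpha /andP[p1 p2] alphaV.
  have := lambda1_ge_explicit Omega p alpha 1 1 oO p1 (lexx 1) ltr01.
  by rewrite invr1 mul1r !mulr1; apply.
- move=> alpha /andP[a0 aV]; cbv zeta; set q := (V / S - _) / _.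
  have [V0 C0 S0] : [/\ 0 < V, 0 < C 2 & 0 < S].
    apply: divr_gt0_factors (lt_trans a0 aV).
    - exact: volume_ge0.
    - exact: C2_ge0.
    - exact: perimeter_ge0.
  have p1 : 1 < 2 :> R by lra.
  apply: le_trans (lambda1_ge _ _ _ _ oO p1 a0 C0 V0 S0 erefl).
  rewrite lee_fin ler_wpM2l ?mulr_ge0 ?invr_ge0 ?(ltW a0) ?(ltW S0) ?(ltW V0)//.
  have -> : 2 - 1 = 1 :> R by lra.
  have -> : 1 - 2 = - 1 :> R by lra.
  rewrite divr1 powRr1; last by rewrite divr_ge0 ?mulr_ge0// ltW.
  rewrite powR_inv1; last by rewrite addr_ge0// divr_ge0 ?mulr_ge0// ltW.
  have aC0 : 0 < alpha * C 2 by rewrite mulr_gt0.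
  (* Positivity of [q] is the upper bound on [alpha], and [1 + q = V / (S * alpha * C 2)] is the
     inverse of the quantity added to 1 in the general bound. *)
  apply: stated_bound2_le.
    rewrite divr_gt0// subr_gt0 ltr_pdivlMr//.
    by move: aV; rewrite ltr_pdivlMr ?mulr_gt0// mulrA.
  rewrite -[perimeter Omega]/S -[volume Omega]/V -[C2 Omega 2]/(C 2) /q.
  have VE : S * (alpha * C 2) + (V + - (alpha * C 2) * S) = V by ring.
  by field; rewrite VE !gt_eqF.
Qed.
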